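(* Let $B, C > 0$ and $p \in \mathbb{R}$, and let $\{\varphi^t_{\rm V}\}_{t \geq 0}$ be the dynamical system on $\mathbb{R}^3$ generated by the Vallis system $$\dot{x} = B y - C(x+p), \qquad \dot{y} = xz - y, \qquad \dot{z} = -xy - z + 1 .$$ Let $\mathcal{A}_{\rm V} \subset \mathbb{R}^3$ be the global B-attractor of $\{\varphi^t_{\rm V}\}_{t\ge 0}$. Then its Lyapunov dimension satisfies $$\dim_{\rm L} \mathcal{A}_{\rm V} \leq 3 - \frac{2(C+2)}{C + 1 + \sqrt{(C-1)^2 + \frac{25}{4} B}} .$$
   Context: For $t \ge 0$ and $u \in \mathbb{R}^3$, $\varphi^t_{\rm V}(u)$ denotes the value at time $t$ of the solution of the system with initial data $u$ at time $0$. Global B-attractor: a nonempty, closed, bounded set $\mathcal{A}_{\rm V} \subset \mathbb{R}^3$ that is invariant, i.e. $\varphi^t_{\rm V}(\mathcal{A}_{\rm V}) = \mathcal{A}_{\rm V}$ for all $t \geq 0$, and that uniformly attracts every bounded set, i.e. for every bounded $K \subset \mathbb{R}^3$, $\sup_{u \in K} \operatorname{dist}(\varphi^t_{\rm V}(u), \mathcal{A}_{\rm V}) \to 0$ as $t \to +\infty$. Lyapunov dimension: for $t > 0$ and $u \in \mathbb{R}^3$, let $\sigma_1(t,u) \geq \sigma_2(t,u) \geq \sigma_3(t,u) > 0$ be the singular values of the Jacobian matrix $D\varphi^t_{\rm V}(u)$ (derivative with respect to the initial data $u$), and define the finite-time Lyapunov exponents $\mathrm{LE}_i(t,u) = \frac{1}{t}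 \ln \sigma_i(t,u)$, $i = 1,2,3$. Let $j(t,u) = \max\{ m \in \{0,1,2,3\} : \sum_{i=1}^m \mathrm{LE}_i(t,u) \geq 0\}$ (the empty sum is $0$). The finite-time local Lyapunov dimension (Kaplan–Yorke formula) is $$\dim_{\rm L}(t,u) = j(t,u) + \frac{\sum_{i=1}^{j(t,u)} \mathrm{LE}_i(t,u)}{|\mathrm{LE}_{j(t,u)+1}(t,u)|} \quad \text{if } j(t,u) \in \{1,2\},$$ with $\dim_{\rm L}(t,u) = 0$ if $j(t,u) = 0$ and $\dim_{\rm L}(t,u) = 3$ if $j(t,u) = 3$. The Lyapunov dimension of a nonempty closed bounded invariant set $\mathcal{A}$ is $$\dim_{\rm L} \mathcal{A} = \inf_{t > 0} \ \sup_{u \in \mathcal{A}} \dim_{\rm L}(t,u).$$ *)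

(* Defs.v *)
From HB Require Import structures.
From mathcomp Require Import all_boot all_order all_algebra.
From mathcomp Require Import all_classical all_reals all_analysis.

Set Implicit Arguments.
Unset Strict Implicit.
Unset Printing Implicit Defensive.

Import Order.TTheory GRing.Theory Num.Theory.
Import numFieldNormedType.Exports.

Local Open Scope classical_set_scope.
Local Open Scope ring_scope.

(* Points of R^3 are row vectors (the convention of [jacobian]); the
   coordinates x, y, z are the entries 0, 1, 2. *)

Definition vallis_field (R : realType) (B C p : R) (v : 'rV[R]_3) : 'rV[R]_3 :=
  let x := v 0 0 in let y := v 0 1 in let z := v 0 2%:R in
  \row_(i < 3) [:: B * y - C * (x + p);
                   x * z - y;
                   - (x * y) - z + 1]`_i.

(* [phi t u] is the value at time t of the solution starting from u.  Only
   t >= 0 is constrained: solutions are continuous on [0, +oo[ and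
   differentiable on ]0, +oo[, so that the values of [phi] at negative times
   play no role (the one-sided derivative at 0 then exists automatically). *)
Definition semiflow_generated_by (R : realType) (n : nat)
    (F : 'rV[R]_n -> 'rV[R]_n) (phi : R -> 'rV[R]_n -> 'rV[R]_n) : Prop :=
  forall u : 'rV[R]_n,
    [/\ phi 0 u = u,
        {within [set t : R | 0 <= t], continuous (phi^~ u)} &
        forall t : R, 0 < t -> is_derive t (1 : R) (phi^~ u) (F (phi t u))].

(* The library norm on matrices is the max norm, hence this definition. *)
Definition enorm (R : realType) (n : nat) (v : 'rV[R]_n) : R :=
  Num.sqrt (\sum_(i < n) v 0 i ^+ 2).

Definition edistance (R : realType) (n : nat)
    (u : 'rV[R]_n) (A : set 'rV[R]_n) : \bar R :=
  ereal_inf [set (enorm (u - a))%:E | a in A].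

(* [K !=set0] is needed because [ereal_sup set0 = -oo]; attraction of the empty
   set is void. *)
Definition uniformly_attracts (R : realType) (n : nat)
    (phi : R -> 'rV[R]_n -> 'rV[R]_n) (A K : set 'rV[R]_n) : Prop :=
  K !=set0 ->
  ereal_sup [set edistance (phi t u) A | u in K] @[t --> +oo%R] --> 0%E.

Definition global_B_attractor (R : realType) (n : nat)
    (phi : R -> 'rV[R]_n -> 'rV[R]_n) (A : set 'rV[R]_n) : Prop :=
  [/\ A !=set0, closed A, bounded_set A,
      (forall t : R, 0 <= t -> phi t @` A = A) &
      forall K : set 'rV[R]_n, bounded_set K -> uniformly_attracts phi A K].

(* The singular values are the square roots of the eigenvalues of M^T M,
   listed with algebraic multiplicity in nonincreasing order. *)
Definition is_singular_values (R : realType) (n : nat)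
    (M : 'M[R]_n) (s : 'rV[R]_n) : Prop :=
  [/\ forall i, 0 <= s 0 i,
      forall i j : 'I_n, (i <= j)%N -> s 0 j <= s 0 i &
      char_poly (M^T *m M) = \prod_(i < n) ('X - (s 0 i ^+ 2)%:P)].

(* Such an s always exists (spectral theorem) and is unique, so the default
   value 0 of [xget] is never used. *)
Definition singular_values (R : realType) (n : nat) (M : 'M[R]_n) : 'rV[R]_n :=
  xget 0 [set s | is_singular_values M s].

Section LyapunovDimension.
Variables (R : realType) (phi : R -> 'rV[R]_3 -> 'rV[R]_3).

(* [jacobian f u] acts on row vectors by right multiplication, so the usual
   Jacobian matrix (entries d f_i / d u_j) is its transpose. *)
Definition flow_jacobian (t : R) (u : 'rV[R]_3) : 'M[R]_3 :=
  (jacobian (phi t) u)^T.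

(* LE_{i+1}(t, u): indices are shifted to start at 0. *)
Definition LE (t : R) (u : 'rV[R]_3) (i : 'I_3) : R :=
  t^-1 * ln (singular_values (flow_jacobian t u) 0 i).

Definition LEsum (t : R) (u : 'rV[R]_3) (m : nat) : R :=
  \sum_(i < 3 | (i < m)%N) LE t u i.

Definition KY_index (t : R) (u : 'rV[R]_3) : nat :=
  \max_(m < 4 | 0 <= LEsum t u m) m.

(* With indices starting at 0, LE_{j+1} is [LE t u (inord j)]. *)
Definition local_dimL (t : R) (u : 'rV[R]_3) : R :=
  let j := KY_index t u in
  if j == 0%N then 0
  else if j == 3%N then 3
  else j%:R + LEsum t u j / `|LE t u (inord j)|.

Definition dimL (A : set 'rV[R]_3) : \bar R :=
  ereal_inf [set ereal_sup [set (local_dimL t u)%:E | u in A]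
            | t in [set t : R | 0 < t]].

End LyapunovDimension.

(* Main.v *)
Require Import Defs.
From mathcomp Require Import all_boot all_order all_algebra.
From mathcomp Require Import all_classical all_reals all_analysis.
From mathcomp Require Import complex ring lra.

Import Order.TTheory GRing.Theory Num.Theory.
Import numFieldNormedType.Exports.

Local Open Scope classical_set_scope.
Local Open Scope ring_scope.

Set Implicit Arguments.
Unset Strict Implicit.
Unset Printing Implicit Defensive.

(* On a bounded invariant set y^2 + z^2 <= 1, because (y^2 + z^2)' <=
   1 - (y^2 + z^2).  In the norm a^2 + B (b^2 + c^2) the symmetric part of the
   linearised field depends on (y, z) only, and on the slightly larger disc of
   radius 5/4 it is bounded below by - Lambda1 with
   Lambda1 = (C + 1 + sqrt ((C - 1)^2 + 81/16 B)) / 2.  Hence the smallest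
   Lyapunov exponent is at least - Lambda1 - O(1/t); as 81/16 < 25/4 this is
   at least - Lambda for large t, Lambda being the same expression with 25/4.
   The exponents sum to the divergence - (C + 2), or less, and the
   Kaplan-Yorke formula then yields the bound 3 - (C + 2) / Lambda.

   The field is quadratic, so the difference of two solutions satisfies exactly
   the linear equation at their midpoint.  Gronwall estimates for such
   differences give the differentiability of the flow, the bound on its
   derivative and the bound on the Jacobian determinant, all without solving the
   variational equation. *)

(** * Singular values *)

Lemma char_poly_conjmx (F : comUnitRingType) (n : nat) (P D : 'M[F]_n) :
  P \in unitmx -> char_poly (invmx P *m D *m P) = char_poly D.
Proof.
move=> Pu; rewrite /char_poly /char_poly_mx.
have -> : 'X%:M - map_mx polyC (invmx P *m D *m P) =
    map_mx polyC (invmx P) *m ('X%:M - map_mx polyC D) *m map_mx polyC P.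
  rewrite mulmxBr mulmxBl !map_mxM; congr (_ - _).
  by rewrite scalar_mxC -mulmxA -map_mxM mulVmx// map_mx1 mulmx1.
rewrite !det_mulmx mulrAC -det_mulmx -map_mxM mulVmx// map_mx1 det1.
by rewrite mul1r.
Qed.

(** Over the complex extension a real symmetric matrix is hermitian, so the spectral theorem
    diagonalises it with real eigenvalues; the factorisation descends because [real_complex] is
    injective on polynomials. *)
Lemma char_poly_symmetric_split (R : rcfType) (n : nat) (A : 'M[R]_n) :
  A^T = A -> exists d : 'I_n -> R, char_poly A = \prod_(i < n) ('X - (d i)%:P).
Proof.
move=> symA.
pose AC := map_mx (real_complex R) A.
have hAC : AC \is hermsymmx.
  apply: realsym_hermsym.
    apply/is_hermitianmxP; rewrite expr0 scale1r map_mx_id//.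
    by apply/matrixP => i j; rewrite !mxE -[in LHS]symA mxE.
  apply/mxOverP => i j; rewrite mxE.
  by apply/complex_realP; exists (A i j).
have /mxOverP spR := hermitian_spectral_diag_real hAC.
have /hermitian_normalmx /orthomx_spectralP := hAC.
set P := spectralmx AC; set sp := spectral_diag AC => eqAC.
have Pu : P \in unitmx by exact: spectral_unit.
have cpE : char_poly AC = \prod_(i < n) ('X - (sp 0 i)%:P).
  rewrite eqAC char_poly_conjmx//.
  rewrite char_poly_trig ?diag_mx_is_trig//; apply: eq_bigr => i _.
  by rewrite !mxE eqxx mulr1n.
exists (fun i => complex.Re (sp 0 i)).
apply: (map_inj_poly (@complexI R)) => //=.
rewrite -map_char_poly -/AC in cpE *.
rewrite cpE rmorph_prod/=; apply: eq_bigr => i _.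
by rewrite rmorphB/= map_polyX map_polyC/= RRe_real.
Qed.

Lemma dotmx_self_ge0 (R : realDomainType) (n : nat) (v : 'rV[R]_n) :
  0 <= (v *m v^T) 0 0.
Proof. by rewrite mxE sumr_ge0// => i _; rewrite mxE -expr2 sqr_ge0. Qed.

Lemma dotmx_self_gt0 (R : realDomainType) (n : nat) (v : 'rV[R]_n) :
  v != 0 -> 0 < (v *m v^T) 0 0.
Proof.
move=> v0; rewrite lt_def dotmx_self_ge0 andbT; apply: contra v0.
rewrite mxE psumr_eq0; last by move=> i _; rewrite mxE -expr2 sqr_ge0.
move=> /allP vi0; apply/eqP/rowP => i; rewrite mxE; apply/eqP.
by have := vi0 i (mem_index_enum i); rewrite mxE -expr2 sqrf_eq0.
Qed.

(** Pairing [v *m (M^T *m M) = a *: v] with [v] makes the root [a] a quotient of squared Euclidean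
    norms. This yields both [0 <= a] and lower bounds for singular values. *)
Lemma gram_eigenvector (R : realFieldType) (n : nat) (M : 'M[R]_n) (a : R) :
  root (char_poly (M^T *m M)) a -> exists2 v : 'rV[R]_n, v != 0 &
    (v *m M^T *m (v *m M^T)^T) 0 0 = a * (v *m v^T) 0 0.
Proof.
rewrite -eigenvalue_root_char => /eigenvalueP[v vE v0]; exists v => //.
by rewrite trmx_mul trmxK mulmxA -(mulmxA v) vE -scalemxAl mxE.
Qed.

Lemma singular_valuesP (R : realType) (n : nat) (M : 'M[R]_n) :
  is_singular_values M (singular_values M).
Proof.
apply: xgetPex.
have [|d dE] := @char_poly_symmetric_split R n (M^T *m M).
  by rewrite trmx_mul trmxK.
have d_ge0 i : 0 <= d i.
  have [] := @gram_eigenvector R n M (d i).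
    rewrite dE; apply/rootP; rewrite horner_prod (bigD1 i)//= hornerXsubC.
    by rewrite subrr mul0r.
  move=> v v0 vE; rewrite -(pmulr_lge0 _ (dotmx_self_gt0 v0)) -vE.
  exact: dotmx_self_ge0.
(* The roots come in no particular order, whereas [is_singular_values] wants them nonincreasing. *)
pose s := sort >=%R [seq d i | i <- enum 'I_n].
have sz_s : size s = n by rewrite size_sort size_map size_enum_ord.
have s_ge0 k : 0 <= s`_k.
  have [lt_k|ge_k] := ltnP k (size s); last by rewrite nth_default.
  by have := mem_nth 0 lt_k; rewrite mem_sort => /mapP[i _ ->].
exists (\row_i Num.sqrt s`_i); split.
- by move=> i; rewrite mxE sqrtr_ge0.
- move=> i j ij; rewrite !mxE ler_wsqrtr//.
  have := @sorted_leq_nth _ >=%R ge_trans ge_refl 0 s.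
  apply => //; rewrite ?inE ?sz_s//.
  by apply: sort_sorted => x y; exact: le_total.
- rewrite dE -(big_enum _ _ _ (fun i => 'X - (d i)%:P)) /=.
  rewrite -(big_map d predT (fun x => 'X - x%:P)).
  rewrite -(perm_big _ (permEl (perm_sort >=%R _))) /= -/s.
  rewrite (big_nth 0) sz_s big_mkord; apply: eq_bigr => i _.
  by rewrite mxE sqr_sqrtr.
Qed.

(** At 0 the characteristic polynomial of [M^T *m M] equals [(-1)^n] times [det(M)^2], and also
    [(-1)^n] times the product of the squared singular values. Both sides being nonnegative, it
    suffices to compare squares. *)
Lemma prod_singular_values (R : realType) (n : nat) (M : 'M[R]_n) :
  \prod_(i < n) singular_values M 0 i = `|\det M|.
Proof.
have [s_ge0 _ sE] := singular_valuesP M.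
apply/eqP; rewrite -(@eqrXn2 _ 2)//; last exact: prodr_ge0.
rewrite real_normK ?num_real// -prodrXl.
have := char_poly_det (M^T *m M); rewrite sE det_mulmx det_tr -expr2 -horner_coef0.
rewrite horner_prod.
under eq_bigr do rewrite hornerXsubC sub0r -mulN1r.
rewrite big_split/= prodr_const card_ord => /mulfI -> //.
by rewrite expf_neq0// oppr_eq0 oner_eq0.
Qed.

Lemma singular_value_eigenvector (R : realType) (n : nat) (M : 'M[R]_n) i :
  exists2 v : 'rV[R]_n, v != 0 & (v *m M^T *m (v *m M^T)^T) 0 0 =
    singular_values M 0 i ^+ 2 * (v *m v^T) 0 0.
Proof.
have [_ _ sE] := singular_valuesP M; apply: gram_eigenvector; rewrite sE.
apply/rootP; rewrite horner_prod (bigD1 i)//= hornerXsubC.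
by rewrite subrr mul0r.
Qed.

(** * Differential inequalities *)

Section DerivOn.
Variables (R : realType) (T : R).

(** These are the hypotheses of the mean value theorem; at time 0 a semiflow is only given to be
    continuous. *)
Definition deriv_on (f df : R -> R) : Prop :=
  {within `[0, T], continuous f} /\
  forall t, 0 < t < T -> is_derive t 1 f (df t).

Lemma deriv_on_eq f df dg : deriv_on f df ->
  (forall t, 0 < t < T -> dg t = df t) -> deriv_on f dg.
Proof. by move=> [cf Df] e; split=> // t tT; rewrite e//; exact: Df. Qed.

Lemma deriv_on_cst c : deriv_on (fun=> c) (fun=> 0).
Proof.
split=> [|t _]; last exact: is_derive_cst.
by apply: continuous_subspaceT => x; exact: cvg_cst.
Qed.

Lemma deriv_onD f g df dg : deriv_on f df -> deriv_on g dg ->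
  deriv_on (fun t => f t + g t) (fun t => df t + dg t).
Proof.
move=> [cf Df] [cg Dg]; split=> [x|t tT]; first exact: cvgD (cf x) (cg x).
exact: is_deriveD (Df _ tT) (Dg _ tT).
Qed.

Lemma deriv_onM f g df dg : deriv_on f df -> deriv_on g dg ->
  deriv_on (fun t => f t * g t) (fun t => df t * g t + f t * dg t).
Proof.
move=> [cf Df] [cg Dg]; split=> [x|t tT]; first exact: cvgM (cf x) (cg x).
apply: is_derive_eq (is_deriveM (Df _ tT) (Dg _ tT)) _.
by rewrite /GRing.scale/= addrC mulrC.
Qed.

Lemma deriv_onZ c f df : deriv_on f df ->
  deriv_on (fun t => c * f t) (fun t => c * df t).
Proof.
move=> Df; apply: deriv_on_eq (deriv_onM (deriv_on_cst c) Df) _ => t _ /=.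
by rewrite mul0r add0r.
Qed.

Lemma deriv_onB f g df dg : deriv_on f df -> deriv_on g dg ->
  deriv_on (fun t => f t - g t) (fun t => df t - dg t).
Proof.
move=> [cf Df] [cg Dg]; split=> [x|t tT]; first exact: cvgB (cf x) (cg x).
exact: is_deriveB (Df _ tT) (Dg _ tT).
Qed.

Lemma deriv_on_expR c : deriv_on (fun t => expR (c * t)) (fun t => c * expR (c * t)).
Proof.
have D t : is_derive t (1 : R) (fun t => expR (c * t)) (c * expR (c * t)).
  by apply: is_derive_eq; rewrite /GRing.scale/= mulr1 mulrC.
split=> [|t _] //; apply: continuous_subspaceT => t.
by apply/differentiable_continuous/derivable1_diffP; have [] := D t.
Qed.

(** By the mean value theorem, [expR (- c * t) * f t] does not increase. The function [f] may have
    any sign, so lower bounds follow by passing to [- f]. *)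
Lemma gronwall0 c f df : 0 <= T -> deriv_on f df ->
  (forall t, 0 < t < T -> df t <= c * f t) -> f T <= expR (c * T) * f 0.
Proof.
move=> T0 Df le_df.
have Dg := deriv_onM (deriv_on_expR (- c)) Df.
pose g t := expR (- c * t) * f t.
pose dg t := - c * expR (- c * t) * f t + expR (- c * t) * df t.
suff : g T <= g 0.
  rewrite /g mulr0 expR0 mul1r => /(ler_wpM2l (expR_ge0 (c * T))).
  by rewrite mulrA -expRD mulNr subrr expR0 mul1r.
(* [MVT] asks for a nondegenerate interval. *)
have [->|Tn0] := eqVneq T 0; first by [].
have Tgt0 : 0 < T by rewrite lt_def Tn0.
have D x : x \in `]0, T[ -> is_derive x 1 g (dg x).
  by rewrite in_itv/= => xT; exact: (Dg.2 x xT).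
have [t] := MVT Tgt0 D Dg.1.
rewrite in_itv/= => tT /eqP; rewrite subr_eq => /eqP ->.
rewrite gerDr subr0; apply: mulr_le0_ge0 => //.
have -> : dg t = expR (- c * t) * (df t - c * f t) by rewrite /dg; ring.
by rewrite mulr_ge0_le0 ?expR_ge0// subr_le0 le_df.
Qed.

(** The shifted function [f + M / c] satisfies the homogeneous inequality. The rate [c] may be
    negative, as it is for determinants. *)
Lemma gronwall c M f df : c != 0 -> 0 <= T -> deriv_on f df ->
  (forall t, 0 < t < T -> df t <= c * f t + M) ->
  f T <= expR (c * T) * (f 0 + M / c) - M / c.
Proof.
move=> c0 T0 Df le_df; rewrite lerBrDr.
apply: (@gronwall0 c (fun t => f t + M / c) df) => //.
  apply: deriv_on_eq (deriv_onD Df (deriv_on_cst (M / c))) _ => t _ /=.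
  by rewrite addr0.
by move=> t tT; rewrite mulrDr mulrCA divff// mulr1; exact: le_df.
Qed.

End DerivOn.

(** The intervals [[a i - b i, a i + b i]] meet pairwise, so the supremum of their left ends lies in
    all of them. This produces limits of difference quotients together with their error bounds. *)
Lemma sup_approx (R : realType) (I : Type) (P : I -> Prop) (a b : I -> R) :
  (exists i, P i) -> (forall i j, P i -> P j -> `|a i - a j| <= b i + b j) ->
  exists l, forall i, P i -> `|a i - l| <= b i.
Proof.
move=> [i0 Pi0] ab.
pose E := [set a i - b i | i in [set i | P i]].
have ubE j : P j -> ubound E (a j + b j).
  move=> Pj _ [i /= Pi <-]; have := ab _ _ Pi Pj; rewrite ler_norml; lra.
have E0 : E !=set0 by exists (a i0 - b i0), i0.
exists (sup E) => i Pi; rewrite ler_distlC.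
apply/andP; split; last by apply: ge_sup => //; exact: ubE.
by apply: ub_le_sup; [exists (a i0 + b i0); exact: ubE|exists i].
Qed.
Lemma deriv_on_sqr (R : realType) (T : R) f df : deriv_on T f df ->
  deriv_on T (fun t => f t ^+ 2) (fun t => 2 * f t * df t).
Proof.
by move=> Df; apply: deriv_on_eq (deriv_onM Df Df) _ => t _ /=; ring.
Qed.

(** * Energy estimates for the linearised equation *)

Section Energy.
Variables (R : realType) (B C : R).
Hypotheses (B_gt0 : 0 < B) (C_gt0 : 0 < C).

Definition energy (a b c : R) : R := a ^+ 2 + B * (b ^+ 2 + c ^+ 2).

(** The larger root [L] of [(L - C) * (L - 1) = 81 / 64 * B]; equivalently, minus the least
    eigenvalue of the quadratic form [- C a^2 + 9/4 sqrt(B) a r - r^2]. *)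
Definition contraction_rate : R :=
  (C + 1 + Num.sqrt ((C - 1) ^+ 2 + 81 / 16 * B)) / 2.

Lemma energy_ge0 a b c : 0 <= energy a b c.
Proof. by rewrite addr_ge0 ?sqr_ge0// mulr_ge0 ?(ltW B_gt0)// addr_ge0 ?sqr_ge0. Qed.

Lemma contraction_rateE : (contraction_rate - C) * (contraction_rate - 1) = 81 / 64 * B.
Proof.
have D0 : 0 <= (C - 1) ^+ 2 + 81 / 16 * B.
  by rewrite addr_ge0 ?sqr_ge0// mulr_ge0 ?(ltW B_gt0)//; lra.
have := sqr_sqrtr D0; rewrite /contraction_rate; set s := Num.sqrt _ => sE.
by transitivity ((s ^+ 2 - (C - 1) ^+ 2) / 4); [field|rewrite sE; field].
Qed.

Lemma contraction_rate_gt : C < contraction_rate /\ 1 < contraction_rate.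
Proof.
have : `|C - 1| < Num.sqrt ((C - 1) ^+ 2 + 81 / 16 * B).
  by rewrite -sqrtr_sqr ltr_sqrt ?ltrDl ?ltr_wpDl ?sqr_ge0//; move: B_gt0; lra.
by rewrite /contraction_rate ltr_norml => /andP[? ?]; split; lra.
Qed.

(* [2 a a' + 2 B (b b' + c c')] along the linearised field at [(x, y, z)]; the
   terms in [x] cancel and the rest depends on [(y, z)] only through
   [m = (1 + z) b - y c], with [m^2 <= ((1 + z)^2 + y^2) (b^2 + c^2)]. *)
Lemma energy_rate x y z a b c : 1 + 2 * z + (y ^+ 2 + z ^+ 2) <= 81 / 16 ->
  - (2 * contraction_rate) * energy a b c <=
  2 * a * (B * b - C * a) +
    B * (2 * b * (z * a + x * c - b) + 2 * c * (- y * a - x * b - c)) <=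
  (B + 6) * energy a b c.
Proof.
move=> yz; set E := (X in _ <= X <= _); pose m := (1 + z) * b - y * c.
have EE : E = - 2 * C * a ^+ 2 - 2 * B * (b ^+ 2 + c ^+ 2) + 2 * B * (a * m).
  by rewrite /E /m; ring.
have bc0 : 0 <= b ^+ 2 + c ^+ 2 by rewrite addr_ge0 ?sqr_ge0.
have a0 : 0 <= a ^+ 2 by exact: sqr_ge0.
have m_le : m ^+ 2 <= 81 / 16 * (b ^+ 2 + c ^+ 2).
  apply: le_trans (ler_wpM2r bc0 yz).
  (* Lagrange's identity: the defect in the Cauchy-Schwarz inequality is a square. *)
  rewrite -subr_ge0 (_ : _ - _ = ((1 + z) * c + y * b) ^+ 2) ?sqr_ge0//.
  by rewrite /m; ring.
rewrite {}EE /energy; move: (b ^+ 2 + c ^+ 2) bc0 m_le => r r0 m_le.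
have [L1 L2] := contraction_rate_gt; have LE := contraction_rateE.
move: contraction_rate L1 L2 LE => L L1 L2 LE; apply/andP; split.
  (* Completing the square: [L - C] times the difference of the two sides is twice the square in
     [sq] plus the term in [hB]. The terms in [m ^+ 2] cancel by [LE]. *)
  have h : 0 <= 16 / 81 * (L - 1) * (81 / 16 * r - m ^+ 2).
    by rewrite mulr_ge0 ?subr_ge0// mulr_ge0//; lra.
  have sq : 0 <= ((L - C) * a + B / 2 * m) ^+ 2 by exact: sqr_ge0.
  rewrite -subr_ge0 -(pmulr_rge0 _ (_ : 0 < L - C)) ?subr_gt0//.
  have hB : 0 <= 2 * (L - C) * B * (16 / 81 * (L - 1) * (81 / 16 * r - m ^+ 2)).
    by rewrite mulr_ge0// mulr_ge0 ?(ltW B_gt0)// mulr_ge0 ?subr_ge0// ltW.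
  have := addr_ge0 hB (mulr_ge0 (ler0n R 2) sq).
  rewrite [X in 0 <= X](_ : _ = (L - C) * (- 2 * C * a ^+ 2 - 2 * B * r +
    2 * B * (a * m) - - (2 * L) * (a ^+ 2 + B * r)))//.
  have -> : 2 * (L - C) * B * (16 / 81 * (L - 1) * (81 / 16 * r - m ^+ 2)) =
    2 * B * (L - C) * (L - 1) * r - 32 / 81 * B * m ^+ 2 * ((L - C) * (L - 1)).
    by field.
  by rewrite LE; field.
(* The upper bound may be crude: its rate enters only the error constants. *)
have am : 2 * (a * m) <= a ^+ 2 + m ^+ 2.
  by rewrite -subr_ge0 (_ : _ - _ = (a - m) ^+ 2) ?sqr_ge0//; ring.
have h1 : 2 * B * (a * m) <= B * (a ^+ 2 + 81 / 16 * r).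
  rewrite (_ : 2 * B * (a * m) = B * (2 * (a * m))); last by ring.
  by rewrite ler_wpM2l ?(ltW B_gt0)//; apply: le_trans am _; rewrite lerD2l.
have h2 := mulr_ge0 (ltW C_gt0) a0.
have h3 := mulr_ge0 (ltW B_gt0) r0.
have h4 := mulr_ge0 (ltW B_gt0) h3.
have h5 := mulr_ge0 (ltW B_gt0) a0.
move: h1; rewrite !mulrDr !mulrDl; lra.
Qed.

(* The field linearised at [(x, y, z)], applied to [(a, b, c)], with a source
   [(0, e1, e2)]. *)
Definition linearised (T : R) (x y z a b c e1 e2 : R -> R) : Prop :=
  [/\ deriv_on T a (fun t => B * b t - C * a t),
      deriv_on T b (fun t => z t * a t + x t * c t - b t + e1 t) &
      deriv_on T c (fun t => - y t * a t - x t * b t - c t + e2 t)].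

Lemma linearised_energy T x y z a b c e1 e2 :
  linearised T x y z a b c e1 e2 ->
  deriv_on T (fun t => energy (a t) (b t) (c t)) (fun t =>
    (2 * a t * (B * b t - C * a t) +
     B * (2 * b t * (z t * a t + x t * c t - b t) +
          2 * c t * (- y t * a t - x t * b t - c t))) +
    2 * B * (b t * e1 t + c t * e2 t)).
Proof.
move=> [/deriv_on_sqr Da /deriv_on_sqr Db /deriv_on_sqr Dc].
apply: deriv_on_eq (deriv_onD Da (deriv_onZ B (deriv_onD Db Dc))) _.
by move=> t _ /=; ring.
Qed.

(* [(1 + z)^2 + y^2 <= (9/4)^2], as when [y^2 + z^2 <= (5/4)^2]. *)
Definition in_strip (T : R) (y z : R -> R) : Prop :=
  forall t, 0 <= t <= T -> 1 + 2 * z t + (y t ^+ 2 + z t ^+ 2) <= 81 / 16.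

Lemma linearised_growth T x y z a b c : 0 <= T -> in_strip T y z ->
  linearised T x y z a b c (fun=> 0) (fun=> 0) ->
  energy (a T) (b T) (c T) <= expR ((B + 6) * T) * energy (a 0) (b 0) (c 0).
Proof.
move=> T0 yz /linearised_energy DE; apply: (gronwall0 T0 DE) => t /andP[t0 tT] /=.
rewrite !mulr0 addr0 mulr0 addr0.
have ht : 0 <= t <= T by rewrite !ltW.
by have /andP[] := energy_rate (x t) (a t) (b t) (c t) (yz t ht).
Qed.

Lemma linearised_decay T x y z a b c : 0 <= T -> in_strip T y z ->
  linearised T x y z a b c (fun=> 0) (fun=> 0) ->
  expR (- (2 * contraction_rate) * T) * energy (a 0) (b 0) (c 0) <=
  energy (a T) (b T) (c T).
Proof.
(* The lower bound is Gronwall's inequality for minus the energy. *)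
move=> T0 yz /linearised_energy /(deriv_onZ (-1)) DE.
rewrite -lerN2 -mulrN -[X in X <= _]mulN1r -[X in _ <= _ * X]mulN1r.
apply: (gronwall0 T0 DE) => t /andP[t0 tT] /=.
rewrite !mulr0 addr0 mulr0 addr0 !mulN1r mulrN lerN2.
have ht : 0 <= t <= T by rewrite !ltW.
by have /andP[] := energy_rate (x t) (a t) (b t) (c t) (yz t ht).
Qed.

(** The source contributes [2 B (b e1 + c e2) <= B (b^2 + c^2) + M], whose first term is at most the
    energy; this raises the rate from [B + 6] to [B + 7]. *)
Lemma linearised_source T x y z a b c e1 e2 M : 0 <= T -> in_strip T y z ->
  linearised T x y z a b c e1 e2 -> a 0 = 0 -> b 0 = 0 -> c 0 = 0 ->
  (forall t, 0 <= t <= T -> B * (e1 t ^+ 2 + e2 t ^+ 2) <= M) ->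
  energy (a T) (b T) (c T) <= expR ((B + 7) * T) * M.
Proof.
move=> T0 yz /linearised_energy DE a0 b0 c0 le_M.
have B7 : B + 7 != 0 by rewrite gt_eqF//; move: B_gt0; lra.
have M0 : 0 <= M.
  apply: le_trans (le_M 0 _); last by rewrite lexx.
  by rewrite mulr_ge0 ?(ltW B_gt0)// addr_ge0 ?sqr_ge0.
apply: le_trans (gronwall (M := M) B7 T0 DE _) _; last first.
  rewrite a0 b0 c0 /energy expr0n/= !addr0 mulr0 !add0r.
  have MB : 0 <= M / (B + 7) <= M.
    rewrite divr_ge0//; last by move: B_gt0; lra.
    by rewrite ler_pdivrMr ?ler_peMr//; move: B_gt0; lra.
  case/andP: MB => MB1 MB2; have := ler_wpM2l (expR_ge0 ((B + 7) * T)) MB2; lra.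
move=> t /andP[t0 tT]; have ht : 0 <= t <= T by rewrite !ltW.
have /andP[_] := energy_rate (x t) (a t) (b t) (c t) (yz t ht).
have := le_M t ht; rewrite /energy => hM.
have am u v : 2 * B * (u * v) <= B * (u ^+ 2 + v ^+ 2).
  rewrite -subr_ge0 (_ : _ - _ = B * (u - v) ^+ 2); last by ring.
  by rewrite mulr_ge0 ?sqr_ge0 ?(ltW B_gt0).
have := am (b t) (e1 t); have := am (c t) (e2 t).
have := sqr_ge0 (a t).
move: hM; rewrite !mulrDr !mulrDl; lra.
Qed.

End Energy.

(** * Determinants of three solutions *)

(** Written out so that derivatives and limits of determinants reduce to those of sums and
    products. *)
Definition det3 (R : pzRingType) (a1 b1 c1 a2 b2 c2 a3 b3 c3 : R) : R :=
  a1 * (b2 * c3 - c2 * b3) - b1 * (a2 * c3 - c2 * a3) + c1 * (a2 * b3 - b2 * a3).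

Lemma det3E (R : comPzRingType) (M : 'M[R]_3) : \det M =
  det3 (M 0 0) (M 0 1) (M 0 2%:R) (M 1 0) (M 1 1) (M 1 2%:R)
       (M 2%:R 0) (M 2%:R 1) (M 2%:R 2%:R).
Proof.
pose f (i j : nat) := M (inord i) (inord j).
have ME i j : M i j = f i j by rewrite /f !inord_val.
rewrite (expand_det_row _ 0) !big_ord_recl big_ord0 /cofactor.
rewrite !(expand_det_row _ 0) !big_ord_recl !big_ord0 /cofactor !det_mx11 !mxE.
rewrite !ME /= /bump /= /det3; ring.
Qed.

(** Liouville's formula: the linearised field has constant trace [- C - 1 - 1], and each source
    enters through the row of its own solution. *)
Lemma det3_deriv (R : realType) (B C T : R) x y z
    a1 b1 c1 a2 b2 c2 a3 b3 c3 e1 f1 e2 f2 e3 f3 :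
  linearised B C T x y z a1 b1 c1 e1 f1 ->
  linearised B C T x y z a2 b2 c2 e2 f2 ->
  linearised B C T x y z a3 b3 c3 e3 f3 ->
  deriv_on T
    (fun t => det3 (a1 t) (b1 t) (c1 t) (a2 t) (b2 t) (c2 t) (a3 t) (b3 t) (c3 t))
    (fun t => - (C + 2) *
      det3 (a1 t) (b1 t) (c1 t) (a2 t) (b2 t) (c2 t) (a3 t) (b3 t) (c3 t) +
      (det3 0 (e1 t) (f1 t) (a2 t) (b2 t) (c2 t) (a3 t) (b3 t) (c3 t) +
       det3 (a1 t) (b1 t) (c1 t) 0 (e2 t) (f2 t) (a3 t) (b3 t) (c3 t) +
       det3 (a1 t) (b1 t) (c1 t) (a2 t) (b2 t) (c2 t) 0 (e3 t) (f3 t))).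
Proof.
move=> [Da1 Db1 Dc1] [Da2 Db2 Dc2] [Da3 Db3 Dc3].
apply: deriv_on_eq (deriv_onD (deriv_onB
  (deriv_onM Da1 (deriv_onB (deriv_onM Db2 Dc3) (deriv_onM Dc2 Db3)))
  (deriv_onM Db1 (deriv_onB (deriv_onM Da2 Dc3) (deriv_onM Dc2 Da3))))
  (deriv_onM Dc1 (deriv_onB (deriv_onM Da2 Db3) (deriv_onM Db2 Da3)))) _.
by move=> t _; rewrite /det3; ring.
Qed.

Lemma normr_det3_le (R : realDomainType) (W1 W2 W3 a1 b1 c1 a2 b2 c2 a3 b3 c3 : R) :
  `|a1| <= W1 -> `|b1| <= W1 -> `|c1| <= W1 ->
  `|a2| <= W2 -> `|b2| <= W2 -> `|c2| <= W2 ->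
  `|a3| <= W3 -> `|b3| <= W3 -> `|c3| <= W3 ->
  `|det3 a1 b1 c1 a2 b2 c2 a3 b3 c3| <= 6 * (W1 * (W2 * W3)).
Proof.
move=> ha1 hb1 hc1 ha2 hb2 hc2 ha3 hb3 hc3.
have minor p q r s : `|p| <= W2 -> `|q| <= W2 -> `|r| <= W3 -> `|s| <= W3 ->
    `|p * s - q * r| <= 2 * (W2 * W3).
  move=> hp hq hr hs; apply: le_trans (ler_normB _ _) _.
  rewrite !normrM (_ : 2 * _ = W2 * W3 + W2 * W3); last by ring.
  by apply: lerD; apply: ler_pM.
have term p m : `|p| <= W1 -> `|m| <= 2 * (W2 * W3) ->
    `|p * m| <= 2 * (W1 * (W2 * W3)).
  move=> hp hm; rewrite normrM mulrCA; exact: ler_pM.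
rewrite /det3 (_ : 6 * _ = 2 * (W1 * (W2 * W3)) + 2 * (W1 * (W2 * W3)) +
  2 * (W1 * (W2 * W3))); last by ring.
apply: le_trans (ler_normD _ _) _; apply: lerD; last by apply: term; last exact: minor.
by apply: le_trans (ler_normB _ _) _; apply: lerD; apply: term => //; exact: minor.
Qed.

(** * The flow and its derivative *)

Lemma coord_le_norm (R : realType) (n : nat) (v : 'rV[R]_n) i : `|v 0 i| <= `|v|.
Proof.
rewrite [leRHS]/Num.Def.normr/= mx_normrE.
exact: (le_bigmax _ (fun ij => `|v ij.1 ij.2|) (0, i)).
Qed.

Lemma norm_le_coord (R : realType) (n : nat) (v : 'rV[R]_n) c : 0 <= c ->
  (forall i, `|v 0 i| <= c) -> `|v| <= c.
Proof.
move=> c0 vc; rewrite [leLHS]/Num.Def.normr/= mx_normrE.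
by apply: bigmax_le => // -[i j] _; rewrite ord1.
Qed.

Lemma mulmxr_continuous (R : realType) m n (L : 'M[R]_(m, n)) :
  continuous (mulmxr L : 'rV[R]_m -> 'rV[R]_n).
Proof.
apply/linear_bounded_continuous/linear_boundedP; near=> r => v.
apply: norm_le_coord => [|j]; first by rewrite mulr_ge0//; near: r; exact: nbhs_pinfty_ge.
rewrite mxE; apply: le_trans (ler_norm_sum _ _ _) _.
apply: le_trans (_ : \sum_i `|L i j| * `|v| <= _).
  apply: ler_sum => i _; rewrite normrM mulrC.
  by apply: ler_wpM2l => //; exact: coord_le_norm.
rewrite -mulr_suml ler_wpM2r//; move: j.
near: r; apply: filter_forall => j; apply: nbhs_pinfty_ge; exact: num_real.
Unshelve. all: by end_near. Qed.

(** A quadratic remainder is [o(h)], so uniqueness of the differential identifies it with right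
    multiplication by [L]. *)
Lemma jacobian_unique (R : realType) m n (f : 'rV[R]_m -> 'rV[R]_n) u
    (L : 'M[R]_(m, n)) r K : 0 < r ->
  (forall h, `|h| <= r -> `|f (u + h) - f u - h *m L| <= K * `|h| ^+ 2) ->
  jacobian f u = L.
Proof.
move=> r0 fL.
have dE : 'd f u = mulmxr L :> ('rV[R]_m -> 'rV[R]_n).
  apply: diff_unique; first exact: mulmxr_continuous.
  apply/eqaddoP => e e0.
  suff : \forall h \near (0 : 'rV[R]_m),
    `|(f \o shift u - (cst (f u) + mulmxr L)) h| <= e * `|h| by [].
  near=> h.
  have -> : (f \o shift u - (cst (f u) + mulmxr L)) h = f (u + h) - f u - h *m L.
    by rewrite -[LHS]/(f (h + u) - (f u + h *m L)) [h + u]addrC opprD addrA.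
  have hr : `|h| <= r by near: h; exact: (@nbhs0_le R ('rV[R]_m : normedModType R)).
  apply: le_trans (fL _ hr) _; rewrite expr2 mulrA ler_wpM2r//.
  apply: le_trans (_ : (`|K| + 1) * `|h| <= _).
    by rewrite ler_wpM2r// (le_trans (ler_norm K))// lerDl.
  rewrite mulrC -ler_pdivlMr; last by rewrite ltr_wpDl.
  by near: h; apply: (@nbhs0_le R ('rV[R]_m : normedModType R)); rewrite divr_gt0// ltr_wpDl.
apply/row_matrixP => i; rewrite [RHS]rowE; apply/rowP => j.
by rewrite !mxE dE/= mxE.
Unshelve. all: by end_near. Qed.

Lemma sum3 (V : nmodType) (f : 'I_3 -> V) : \sum_i f i = f 0 + f 1 + f 2%:R.
Proof.
rewrite !big_ord_recl big_ord0 addr0 addrA.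
by congr (f _ + f _ + f _); exact: val_inj.
Qed.

Lemma prod3 (R : pzSemiRingType) (f : 'I_3 -> R) : \prod_i f i = f 0 * f 1 * f 2%:R.
Proof.
rewrite !big_ord_recl big_ord0 mulr1 mulrA.
by congr (f _ * f _ * f _); exact: val_inj.
Qed.

Lemma semiflow_deriv_on (R : realType) (n : nat) (F : 'rV[R]_n -> 'rV[R]_n) phi
    (T : R) u i :
  semiflow_generated_by F phi ->
  deriv_on T (fun t => phi t u 0 i) (fun t => F (phi t u) 0 i).
Proof.
move=> /(_ u)[_ cphi dphi]; split=> [|t /andP[t0 _]].
  have {}cphi : {within `[0, T], continuous (phi^~ u)}.
    by apply: continuous_subspaceW cphi => t /=; rewrite in_itv/= => /andP[].
  move=> x.
  by have := cvg_comp _ _ (cphi x) (@coord_continuous R 1 n 0 i (phi x u)).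
have [dt tE] := dphi t t0.
apply: DeriveDef; first by have /derivable_mxP := dt; apply.
by rewrite -tE derive_mx// mxE.
Qed.

(** * Dissipation in the (y, z)-plane *)

Section VallisFlow.
Variables (R : realType) (B C p : R) (phi : R -> 'rV[R]_3 -> 'rV[R]_3).
Hypotheses (B_gt0 : 0 < B) (C_gt0 : 0 < C).
Hypothesis phi_vallis : semiflow_generated_by (vallis_field B C p) phi.

Definition yz2 (v : 'rV[R]_3) : R := v 0 1 ^+ 2 + v 0 2%:R ^+ 2.

Lemma phi0 u : phi 0 u = u.
Proof. by have [] := phi_vallis u. Qed.

Lemma deriv_on_x T u :
  deriv_on T (fun t => phi t u 0 0)
    (fun t => B * phi t u 0 1 - C * (phi t u 0 0 + p)).
Proof.
apply: deriv_on_eq (semiflow_deriv_on T u 0 phi_vallis) _.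
by move=> t _; rewrite mxE.
Qed.

Lemma deriv_on_y T u :
  deriv_on T (fun t => phi t u 0 1)
    (fun t => phi t u 0 0 * phi t u 0 2%:R - phi t u 0 1).
Proof.
apply: deriv_on_eq (semiflow_deriv_on T u 1 phi_vallis) _.
by move=> t _; rewrite mxE.
Qed.

Lemma deriv_on_z T u :
  deriv_on T (fun t => phi t u 0 2%:R)
    (fun t => - (phi t u 0 0 * phi t u 0 1) - phi t u 0 2%:R + 1).
Proof.
apply: deriv_on_eq (semiflow_deriv_on T u 2%:R phi_vallis) _.
by move=> t _; rewrite mxE.
Qed.

(** The terms [x y z] cancel in the derivative of [y^2 + z^2], and [2 z <= z^2 + 1] bounds the
    rest. *)
Lemma yz2_decay T u : 0 <= T -> yz2 (phi T u) - 1 <= expR (- T) * (yz2 u - 1).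
Proof.
move=> T0.
have Dy := deriv_on_sqr (deriv_on_y T u).
have Dz := deriv_on_sqr (deriv_on_z T u).
have D := deriv_onB (deriv_onD Dy Dz) (deriv_on_cst T 1).
have := @gronwall0 R T (-1) _ _ T0 D.
rewrite mulN1r phi0; apply => t _.
have := sqr_ge0 (phi t u 0 2%:R - 1).
rewrite sqrrB expr1n; set x := phi t u 0 0; set y := phi t u 0 1; set z := phi t u 0 2%:R.
move=> h.
have -> : 2 * y * (x * z - y) + 2 * z * (- (x * y) - z + 1) - 0 =
  - (2 * y ^+ 2) - 2 * z ^+ 2 + 2 * z by ring.
have := sqr_ge0 y; move: h; rewrite mulr1 -mulr_natl; lra.
Qed.

(** Invariance writes [u] as [phi T v] with [v] in [A] for arbitrarily large [T]. As [yz2] is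
    bounded on [A], [yz2_decay] leaves no room for an excess of [yz2 u] over 1. *)
Lemma yz2_attractor A u : bounded_set A ->
  (forall t, 0 <= t -> phi t @` A = A) -> A u -> yz2 u <= 1.
Proof.
move=> [M [_ bA]] invA Au; rewrite leNgt; apply/negP => q1.
pose K := (`|M| + 1) ^+ 2 + (`|M| + 1) ^+ 2.
have bK v : A v -> yz2 v <= K.
  move=> Av; have {}Av : `|v| <= `|M| + 1.
    by apply: bA => //; rewrite (le_lt_trans (ler_norm M))// ltrDl.
  by apply: lerD; rewrite -real_normK ?num_real// lerXn2r ?nnegrE//;
    apply: le_trans (coord_le_norm _ _) Av.
(* Since [1 + T <= expR T], decay would give [(yz2 u - 1) * (1 + T) <= K], whereas for this [T] the
   left-hand side is [yz2 u - 1 + K]. *)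
pose T := K / (yz2 u - 1).
have T0 : 0 <= T.
  by apply: divr_ge0; [rewrite addr_ge0// sqr_ge0|rewrite subr_ge0 ltW].
have [v Av vu] : (phi T @` A) u by rewrite invA.
have := yz2_decay v T0; rewrite vu.
have : expR (- T) * (yz2 v - 1) <= expR (- T) * K.
  by rewrite ler_wpM2l ?expR_ge0//; have := bK v Av; lra.
move=> h1 h2; have := le_trans h2 h1.
rewrite mulrC expRN ler_pdivlMr ?expR_gt0//.
have := expR_ge1Dx T; rewrite -(ler_pM2l (_ : 0 < yz2 u - 1)) ?subr_gt0// => h3 h4.
have := le_trans h3 h4; rewrite mulrDr mulr1 /T mulrC divfK ?gt_eqF ?subr_gt0//.
lra.
Qed.

Section Base.
Variable u : 'rV[R]_3.
Hypothesis yz2_u : yz2 u <= 1.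

Lemma yz2_base t : 0 <= t -> yz2 (phi t u) <= 1.
Proof.
move=> t0; have := yz2_decay u t0.
have := mulr_ge0_le0 (expR_ge0 (- t)) (_ : yz2 u - 1 <= 0).
rewrite subr_le0 => /(_ yz2_u); lra.
Qed.

(** At time 0 the weighted inequality [amgm] gives at most [5/4 + 10/64 < 25/16]; by [yz2_decay] the
    disc of radius [5/4] is forward invariant. *)
Lemma yz2_near h t : `|h| <= 8^-1 -> 0 <= t -> yz2 (phi t (u + h)) <= 25 / 16.
Proof.
move=> h8 t0; have := yz2_decay (u + h) t0.
have q0 : yz2 (u + h) <= 25 / 16.
  have bh i : (h 0 i) ^+ 2 <= 64^-1.
    rewrite -real_normK ?num_real// (_ : 64^-1 = 8^-1 ^+ 2); last by field.
    by rewrite lerXn2r ?nnegrE//; exact: le_trans (coord_le_norm _ _) h8.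
  have amgm (a b : R) : (a + b) ^+ 2 <= 5 / 4 * a ^+ 2 + 5 * b ^+ 2.
    rewrite -subr_ge0 (_ : _ - _ = (a / 2 - 2 * b) ^+ 2) ?sqr_ge0//.
    by field.
  move: yz2_u; rewrite /yz2 !mxE => yz.
  have := amgm (u 0 1) (h 0 1); have := amgm (u 0 2%:R) (h 0 2%:R).
  have := bh 1; have := bh 2%:R; lra.
have e1 : expR (- t) <= 1 by rewrite expR_le1 oppr_le0.
have := ler_wpM2l (expR_ge0 (- t)) q0.
have := expR_ge0 (- t); lra.
Qed.

(** * Differences of two solutions *)

Definition gap (h : 'rV[R]_3) (t : R) : 'rV[R]_3 := phi t (u + h) - phi t u.

Lemma gap0 h : gap h 0 = h.
Proof. by rewrite /gap !phi0 addrC addKr. Qed.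

Lemma gapE h t i : gap h t 0 i = phi t (u + h) 0 i - phi t u 0 i.
Proof. by rewrite !mxE. Qed.

Let mid h i t := (phi t (u + h) 0 i + phi t u 0 i) / 2.

(** Common to the two expansions below: [n1], [n2], [n3] are the point of linearisation, and only
    the products [x z] and [x y] have to be expanded. *)
Lemma gap_linearised T h n1 n2 n3 e1 e2 :
  (forall t, n3 t * gap h t 0 0 + n1 t * gap h t 0 2%:R + e1 t =
     phi t (u + h) 0 0 * phi t (u + h) 0 2%:R - phi t u 0 0 * phi t u 0 2%:R) ->
  (forall t, n2 t * gap h t 0 0 + n1 t * gap h t 0 1 - e2 t =
     phi t (u + h) 0 0 * phi t (u + h) 0 1 - phi t u 0 0 * phi t u 0 1) ->
  linearised B C T n1 n2 n3
    (fun t => gap h t 0 0) (fun t => gap h t 0 1) (fun t => gap h t 0 2%:R) e1 e2.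
Proof.
move=> E1 E2.
have gapF i : (fun t => gap h t 0 i) =
    (fun t => phi t (u + h) 0 i - phi t u 0 i).
  by apply/funext => t; rewrite gapE.
split.
- rewrite [X in deriv_on _ X](gapF 0).
  apply: deriv_on_eq (deriv_onB (deriv_on_x T (u + h)) (deriv_on_x T u)) _.
  by move=> t _; rewrite !gapE; ring.
- rewrite [X in deriv_on _ X](gapF 1).
  apply: deriv_on_eq (deriv_onB (deriv_on_y T (u + h)) (deriv_on_y T u)) _.
  by move=> t _; rewrite addrAC E1 gapE; ring.
- rewrite [X in deriv_on _ X](gapF 2%:R).
  apply: deriv_on_eq (deriv_onB (deriv_on_z T (u + h)) (deriv_on_z T u)) _.
  move=> t _; have := E2 t; rewrite !gapE => E2t.
  apply/eqP; rewrite -subr_eq0; apply/eqP.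
  rewrite -[RHS](subrr (phi t (u + h) 0 0 * phi t (u + h) 0 1 -
    phi t u 0 0 * phi t u 0 1)) -[in X in _ = _ - X]E2t.
  by ring.
Qed.

Lemma gap_midpoint T h :
  linearised B C T (mid h 0) (mid h 1) (mid h 2%:R)
    (fun t => gap h t 0 0) (fun t => gap h t 0 1) (fun t => gap h t 0 2%:R)
    (fun=> 0) (fun=> 0).
Proof. by apply: gap_linearised => // t; rewrite /mid !gapE; field. Qed.

(** The coefficients do not depend on [h], so gaps can be superposed, at the price of a quadratic
    source. The midpoint in [gap_midpoint] moves with [h]. *)
Lemma gap_base T h :
  linearised B C T (fun t => phi t u 0 0) (fun t => phi t u 0 1)
    (fun t => phi t u 0 2%:R)
    (fun t => gap h t 0 0) (fun t => gap h t 0 1) (fun t => gap h t 0 2%:R)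
    (fun t => gap h t 0 0 * gap h t 0 2%:R)
    (fun t => - (gap h t 0 0 * gap h t 0 1)).
Proof. by apply: gap_linearised => // t; rewrite !gapE; ring. Qed.

Lemma in_strip_base T : in_strip T (fun t => phi t u 0 1) (fun t => phi t u 0 2%:R).
Proof.
move=> t /andP[t0 _]; have := yz2_base t0; rewrite /yz2 => q1.
move: q1; move: (phi t u 0 1) (phi t u 0 2%:R) => y z q1.
have := sqr_ge0 (z - 1); have := sqr_ge0 y.
rewrite (_ : (z - 1) ^+ 2 = z ^+ 2 - 2 * z + 1); last by ring.
lra.
Qed.

(** By convexity the midpoint stays in the disc of radius [5/4]; there [z <= 5/4], and
    [1 + 5/2 + 25/16 = 81/16]. *)
Lemma in_strip_mid T h : `|h| <= 8^-1 -> in_strip T (mid h 1) (mid h 2%:R).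
Proof.
move=> h8 t /andP[t0 _]; have := yz2_base t0; have := yz2_near h8 t0.
rewrite /yz2 /mid; move: (phi t (u + h)) (phi t u) => v w q1 q2.
have z1 := sqr_ge0 (v 0 2%:R - w 0 2%:R).
have y1 := sqr_ge0 (v 0 1 - w 0 1).
have q3 : ((v 0 1 + w 0 1) / 2) ^+ 2 + ((v 0 2%:R + w 0 2%:R) / 2) ^+ 2 <= 25 / 16.
  have sq (a b : R) : ((a + b) / 2) ^+ 2 = (a ^+ 2 + b ^+ 2) / 2 - (a - b) ^+ 2 / 4.
    by field.
  by rewrite !sq; lra.
move: q3; move: ((v 0 1 + w 0 1) / 2) ((v 0 2%:R + w 0 2%:R) / 2) => y z q3.
have := sqr_ge0 y; have := sqr_ge0 (z - 5 / 4).
rewrite (_ : (z - 5 / 4) ^+ 2 = z ^+ 2 - 5 / 2 * z + 25 / 16); last by field.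
lra.
Qed.

Definition energyv (v : 'rV[R]_3) : R := energy B (v 0 0) (v 0 1) (v 0 2%:R).

Lemma gap_growth t h : 0 <= t -> `|h| <= 8^-1 ->
  energyv (gap h t) <= expR ((B + 6) * t) * energyv h.
Proof.
move=> t0 h8.
have := linearised_growth B_gt0 C_gt0 t0 (in_strip_mid h8) (gap_midpoint t h).
by rewrite /energyv !gap0.
Qed.

Lemma gap_decay t h : 0 <= t -> `|h| <= 8^-1 ->
  expR (- (2 * contraction_rate B C) * t) * energyv h <= energyv (gap h t).
Proof.
move=> t0 h8.
have := linearised_decay B_gt0 C_gt0 t0 (in_strip_mid h8) (gap_midpoint t h).
by rewrite /energyv !gap0.
Qed.

Lemma energyv_le_norm h : energyv h <= (1 + 2 * B) * `|h| ^+ 2.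
Proof.
have sq i : h 0 i ^+ 2 <= `|h| ^+ 2.
  by rewrite -[leLHS]real_normK ?num_real// lerXn2r ?nnegrE//; exact: coord_le_norm.
rewrite /energyv /energy; have := sq 0; have := sq 1; have := sq 2%:R.
move=> z y x; have := ler_wpM2l (ltW B_gt0) y; have := ler_wpM2l (ltW B_gt0) z; lra.
Qed.

Lemma coord_le_energyv (v : 'rV[R]_3) i : v 0 i ^+ 2 <= (1 + B^-1) * energyv v.
Proof.
have B0 := B_gt0; have BV : 0 < B^-1 by rewrite invr_gt0.
have [[x0 y0] z0] := (sqr_ge0 (v 0 0), sqr_ge0 (v 0 1), sqr_ge0 (v 0 2%:R)).
have E1 : (1 + B^-1) * energyv v = v 0 0 ^+ 2 + B * (v 0 1 ^+ 2 + v 0 2%:R ^+ 2) +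
   B^-1 * v 0 0 ^+ 2 + (v 0 1 ^+ 2 + v 0 2%:R ^+ 2).
  by rewrite /energyv /energy; field; rewrite gt_eqF.
have h1 : 0 <= B * (v 0 1 ^+ 2 + v 0 2%:R ^+ 2) by rewrite mulr_ge0 ?addr_ge0 ?sqr_ge0// ltW.
have h2 : 0 <= B^-1 * v 0 0 ^+ 2 by rewrite mulr_ge0 ?sqr_ge0// ltW.
rewrite E1; case: i => -[|[|[|//]]] ki.
- rewrite (_ : Ordinal ki = 0); last exact: val_inj; lra.
- rewrite (_ : Ordinal ki = 1); last exact: val_inj; lra.
- rewrite (_ : Ordinal ki = 2%:R); last exact: val_inj; lra.
Qed.

(** Controls the sources of [gap_base]: each left-hand side is half a cross term in the expanded
    square of the energy. *)
Lemma energyv_quadratic (v : 'rV[R]_3) :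
  B * (v 0 0 * v 0 2%:R) ^+ 2 <= energyv v ^+ 2 /\
  B * (v 0 0 * v 0 1) ^+ 2 <= energyv v ^+ 2.
Proof.
rewrite /energyv /energy !exprMn.
have := (sqr_ge0 (v 0 0), sqr_ge0 (v 0 1), sqr_ge0 (v 0 2%:R)).
move: (v 0 0 ^+ 2) (v 0 1 ^+ 2) (v 0 2%:R ^+ 2) => x y z [[x0 y0] z0].
have B0 := ltW B_gt0.
have [xx yz] : 0 <= x ^+ 2 /\ 0 <= (B * (y + z)) ^+ 2 by split; exact: sqr_ge0.
have [xy xz] : 0 <= B * (x * y) /\ 0 <= B * (x * z) by rewrite !mulr_ge0.
have -> : (x + B * (y + z)) ^+ 2 =
  x ^+ 2 + 2 * (B * (x * y)) + 2 * (B * (x * z)) + (B * (y + z)) ^+ 2 by ring.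
by split; lra.
Qed.

Lemma linearised_axpy T x y z a b c e1 e2 a' b' c' e1' e2' k :
  linearised B C T x y z a b c e1 e2 ->
  linearised B C T x y z a' b' c' e1' e2' ->
  linearised B C T x y z (fun t => a t + k * a' t) (fun t => b t + k * b' t)
    (fun t => c t + k * c' t) (fun t => e1 t + k * e1' t) (fun t => e2 t + k * e2' t).
Proof.
move=> [Da Db Dc] [Da' Db' Dc']; split.
- by apply: deriv_on_eq (deriv_onD Da (deriv_onZ k Da')) _ => t _ /=; ring.
- by apply: deriv_on_eq (deriv_onD Db (deriv_onZ k Db')) _ => t _ /=; ring.
- by apply: deriv_on_eq (deriv_onD Dc (deriv_onZ k Dc')) _ => t _ /=; ring.
Qed.

(** * Differentiability of the flow *)

Let basis (e : R) (i : 'I_3) : 'rV[R]_3 := e *: delta_mx 0 i.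

Lemma norm_basis e i : 0 <= e -> `|basis e i| <= e.
Proof.
move=> e0; apply: norm_le_coord => // j; rewrite !mxE eqxx/=.
by case: eqP => _; rewrite ?mulr1 ?mulr0 ?normr0// ger0_norm.
Qed.

(* The left-hand side solves the equation linearised along [phi t u] with zero
   initial value and a source quadratic in the gaps. *)
Lemma gap_defect T : 0 <= T -> exists2 K : R, 0 <= K & forall h e j,
  `|h| <= 8^-1 -> 0 < e <= 8^-1 ->
  `|gap h T 0 j - \sum_i h 0 i / e * gap (basis e i) T 0 j| <=
    K * (`|h| * (`|h| + e)).
Proof.
move=> T0; have B1 : 0 <= 1 + 2 * B by move: B_gt0; lra.
have [N N0 NE] : exists2 N, 0 <= N & N = expR ((B + 6) * T) * (1 + 2 * B).
  by eexists; last reflexivity; rewrite mulr_ge0 ?expR_ge0.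
have gapN h r t : `|h| <= r -> r <= 8^-1 -> 0 <= t <= T ->
    energyv (gap h t) ^+ 2 <= N ^+ 2 * r ^+ 4.
  move=> hr r8 /andP[t0 tT]; have h8 := le_trans hr r8.
  rewrite (_ : N ^+ 2 * r ^+ 4 = (N * r ^+ 2) ^+ 2); last by ring.
  have r0 := le_trans (normr_ge0 h) hr.
  rewrite lerXn2r ?nnegrE ?energy_ge0// ?(mulr_ge0 N0) ?sqr_ge0//.
  apply: le_trans (gap_growth t0 h8) _; rewrite NE -mulrA.
  apply: ler_pM; rewrite ?expR_ge0 ?energy_ge0//.
    by rewrite ler_expR ler_wpM2l//; move: B_gt0; lra.
  apply: le_trans (energyv_le_norm h) _; rewrite ler_wpM2l//.
  by rewrite lerXn2r ?nnegrE.
(* The factors come from [coord_le_energyv], from [linearised_source], and from two source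
   components, each bounded by 16 times [S] below. *)
pose K2 := (1 + B^-1) * (expR ((B + 7) * T) * (32 * N ^+ 2)).
have K20 : 0 <= K2.
  rewrite /K2 mulr_ge0 ?mulr_ge0 ?expR_ge0 ?sqr_ge0//.
  by rewrite addr_ge0// invr_ge0 ltW.
exists (Num.sqrt K2); first exact: sqrtr_ge0.
move=> h e j h8 /andP[e0 e8].
have he0 : 0 <= `|h| * (`|h| + e) by rewrite mulr_ge0// addr_ge0// ltW.
rewrite -ler_sqr ?nnegrE ?(mulr_ge0 (sqrtr_ge0 _))//.
rewrite real_normK ?num_real// exprMn sqr_sqrtr//.
(* With these coefficients the initial value of [d] is [h] minus its expansion in the basis, hence
   0. *)
pose k i := - (h 0 i / e).
pose d t := gap h t + k 0 *: gap (basis e 0) t + k 1 *: gap (basis e 1) t +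
  k 2%:R *: gap (basis e 2%:R) t.
have lin := linearised_axpy (k 2%:R) (linearised_axpy (k 1) (linearised_axpy (k 0)
  (gap_base T h) (gap_base T (basis e 0))) (gap_base T (basis e 1)))
  (gap_base T (basis e 2%:R)).
have dE i t : d t 0 i = gap h t 0 i + k 0 * gap (basis e 0) t 0 i +
    k 1 * gap (basis e 1) t 0 i + k 2%:R * gap (basis e 2%:R) t 0 i.
  by rewrite /d !mxE.
have -> : gap h T 0 j - \sum_i h 0 i / e * gap (basis e i) T 0 j = d T 0 j.
  by rewrite dE sum3 /k; ring.
have d0 i : d 0 0 i = 0.
  rewrite dE !gap0 !mxE /k.
  case: i => -[|[|[|//]]] ki.
  - rewrite (_ : Ordinal ki = 0); last exact: val_inj.
    by rewrite !eqxx/=; field; rewrite gt_eqF.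
  - rewrite (_ : Ordinal ki = 1); last exact: val_inj.
    by rewrite !eqxx/=; field; rewrite gt_eqF.
  - rewrite (_ : Ordinal ki = 2%:R); last exact: val_inj.
    by rewrite !eqxx/=; field; rewrite gt_eqF.
(* Dominates both kinds of source terms, of orders [|h|^4] and [(h_i / e)^2 e^4 = h_i^2 e^2]. *)
pose S := N ^+ 2 * (`|h| * (`|h| + e)) ^+ 2.
have cauchy4 (a b c f : R) : B * a ^+ 2 <= S -> B * b ^+ 2 <= S ->
    B * c ^+ 2 <= S -> B * f ^+ 2 <= S -> B * (a + b + c + f) ^+ 2 <= 16 * S.
  move=> ha hb hc hf.
  have : B * (a + b + c + f) ^+ 2 <=
      B * (4 * (a ^+ 2 + b ^+ 2 + c ^+ 2 + f ^+ 2)).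
    rewrite ler_wpM2l//; first exact: ltW.
    have := (sqr_ge0 (a - b), sqr_ge0 (a - c), sqr_ge0 (a - f)).
    have := (sqr_ge0 (b - c), sqr_ge0 (b - f), sqr_ge0 (c - f)).
    by move=> [[? ?] ?] [[? ?] ?]; rewrite !expr2 in ha hb hc hf *; nra.
  move=> /le_trans; apply; rewrite !mulrDr.
  by lra.
have srch t : 0 <= t <= T -> energyv (gap h t) ^+ 2 <= S.
  move=> tT; apply: le_trans (gapN h _ t (lexx _) h8 tT) _.
  rewrite /S ler_wpM2l ?sqr_ge0// exprMn (_ : `|h| ^+ 4 = `|h| ^+ 2 * `|h| ^+ 2); last by ring.
  by rewrite ler_wpM2l ?sqr_ge0// lerXn2r ?nnegrE ?lerDl ?addr_ge0// ltW.
have srcb i t : 0 <= t <= T -> k i ^+ 2 * energyv (gap (basis e i) t) ^+ 2 <= S.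
  move=> tT; have := gapN _ e t (norm_basis i (ltW e0)) e8 tT.
  move=> /(ler_wpM2l (sqr_ge0 (k i))) /le_trans; apply.
  rewrite (_ : k i ^+ 2 * _ = N ^+ 2 * (h 0 i ^+ 2 * e ^+ 2)); last first.
    by rewrite /k; field; rewrite gt_eqF.
  rewrite /S ler_wpM2l ?sqr_ge0// exprMn ler_pM ?sqr_ge0//.
    rewrite -[leLHS]real_normK ?num_real// lerXn2r ?nnegrE//.
    exact: coord_le_norm.
  by rewrite lerXn2r ?nnegrE ?lerDr ?addr_ge0// ltW.
have BkM a (q : R) : B * (a * q) ^+ 2 = a ^+ 2 * (B * q ^+ 2) by ring.
have := linearised_source (M := 32 * S) B_gt0 C_gt0 T0 (@in_strip_base T) lin.
rewrite -!dE !d0 => /(_ erefl erefl erefl) dT.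
apply: le_trans (coord_le_energyv (d T) j) _.
rewrite (_ : K2 * _ = (1 + B^-1) * (expR ((B + 7) * T) * (32 * S))); last first.
  by rewrite /K2 /S; ring.
rewrite ler_wpM2l//; first by rewrite addr_ge0// invr_ge0 ltW.
apply: dT => t tT.
have [h1 h2] := energyv_quadratic (gap h t).
have b i := energyv_quadratic (gap (basis e i) t).
have kb i : B * (k i * (gap (basis e i) t 0 0 * gap (basis e i) t 0 2%:R)) ^+ 2 <= S
   /\ B * (k i * - (gap (basis e i) t 0 0 * gap (basis e i) t 0 1)) ^+ 2 <= S.
  have [b1 b2] := b i; split; apply: (le_trans _ (srcb i t tT)); rewrite BkM.
    by apply: ler_wpM2l b1; exact: sqr_ge0.
  by rewrite [(- (gap _ _ _ _ * _)) ^+ 2]sqrrN; apply: ler_wpM2l b2; exact: sqr_ge0.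
have [p0 q0] := kb 0; have [p1 q1] := kb 1; have [p2 q2] := kb 2%:R.
have sh := srch t tT.
rewrite mulrDr (_ : 32 * S = 16 * S + 16 * S); last by ring.
by apply: lerD; apply: cauchy4 => //; rewrite ?sqrrN; apply: (le_trans _ sh).
Qed.
(** [gap_defect] is used twice: between steps [e] and [f] along one axis, it gives the columns'
    difference quotients a limit; with [e] equal to the norm of [h], it compares [h] with the
    axes. *)
Lemma gap_expansion T : 0 <= T -> exists (K : R) (L : 'M[R]_3), 0 <= K /\
  forall h j, `|h| <= 8^-1 ->
    `|gap h T 0 j - (h *m L) 0 j| <= K * `|h| ^+ 2.
Proof.
move=> T0; have [K K0 defect] := gap_defect T0.
have col i j : exists l, forall e, 0 < e <= 8^-1 ->
    `|gap (basis e i) T 0 j / e - l| <= K * e.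
  apply: (sup_approx (P := fun e => 0 < e <= 8^-1)
    (a := fun e => gap (basis e i) T 0 j / e)).
    by exists 8^-1; rewrite lexx invr_gt0 ltr0n.
  move=> e f /andP[e0 e8] /andP[f0 f8]; have ne := norm_basis i (ltW e0).
  have f08 : 0 < f <= 8^-1 by rewrite f0.
  have := defect _ f j (le_trans ne e8) f08.
  rewrite (bigD1 i)//= big1 ?addr0; last first.
    by move=> k /negPf ki; rewrite !mxE eqxx ki mulr0 !mul0r.
  rewrite !mxE !eqxx mulr1 => hd.
  have {}hd := le_trans hd (_ : _ <= K * (e * (e + f))).
  have {hd} := hd (ler_wpM2l K0 (ler_pM _ _ ne (lerD ne (lexx f)))).
  move=> /(_ (normr_ge0 _) (addr_ge0 (normr_ge0 _) (ltW f0))).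
  rewrite -(ler_pM2l (_ : 0 < e^-1)) ?invr_gt0//.
  rewrite -[X in X * `|_| <= _]ger0_norm ?invr_ge0 ?(ltW e0)// -normrM => le_ef.
  apply: le_trans (_ : e^-1 * (K * (e * (e + f))) <= _).
    apply: le_trans le_ef; rewrite le_eqVlt; apply/orP; left; apply/eqP.
    by congr (`|_|); field; rewrite !gt_eqF.
  by rewrite le_eqVlt; apply/orP; left; apply/eqP; field; rewrite gt_eqF.
pose L : 'M[R]_3 := \matrix_(i, j) sval (cid (col i j)).
have LP i j e : 0 < e <= 8^-1 -> `|gap (basis e i) T 0 j / e - L i j| <= K * e.
  by move=> he; rewrite [L i j]mxE; exact: (svalP (cid (col i j)) e he).
(* The defect at step [|h|] costs [2 * K], and the three axes cost [K] each. *)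
exists (5 * K), L; split; first exact: mulr_ge0.
move=> h j h8; have [->|hn0] := eqVneq h 0.
  by rewrite /gap addr0 subrr mul0mx !mxE subrr !normr0 expr0n/= mulr0.
have e0 : 0 < `|h| by rewrite normr_gt0.
have e08 : 0 < `|h| <= 8^-1 by rewrite e0.
have := defect h `|h| j h8 e08.
set S := \sum_i _ => h1.
have h2 : `|S - (h *m L) 0 j| <= 3 * (K * `|h| ^+ 2).
  rewrite mxE /S -sumrB; apply: le_trans (ler_norm_sum _ _ _) _.
  have le_term i : `|h 0 i / `|h| * gap (basis `|h| i) T 0 j - h 0 i * L i j| <=
      K * `|h| ^+ 2.
    rewrite (_ : _ - _ = h 0 i * (gap (basis `|h| i) T 0 j / `|h| - L i j)); last by ring.
    rewrite normrM expr2 mulrCA ler_pM ?coord_le_norm//.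
    exact: LP.
  have -> : 3 * (K * `|h| ^+ 2) = K * `|h| ^+ 2 + K * `|h| ^+ 2 + K * `|h| ^+ 2.
    by ring.
  rewrite sum3.
  by rewrite !lerD.
rewrite (_ : _ - _ = (gap h T 0 j - S) + (S - (h *m L) 0 j)); last by ring.
apply: le_trans (ler_normD _ _) _; apply: le_trans (lerD h1 h2) _.
by rewrite le_eqVlt; apply/orP; left; apply/eqP; ring.
Qed.
Lemma jacobian_approx T : 0 <= T -> exists K : R, 0 <= K /\
  forall h j, `|h| <= 8^-1 ->
    `|gap h T 0 j - (h *m jacobian (phi T) u) 0 j| <= K * `|h| ^+ 2.
Proof.
move=> T0; have [K [L [K0 KL]]] := gap_expansion T0.
suff -> : jacobian (phi T) u = L by exists K.
apply: (@jacobian_unique _ _ _ _ _ _ 8^-1 K) => // h h8.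
apply: norm_le_coord => [|j]; first by rewrite mulr_ge0 ?sqr_ge0.
have -> : (phi T (u + h) - phi T u - h *m L) 0 j = gap h T 0 j - (h *m L) 0 j.
  by rewrite [LHS]mxE; congr (_ + _); rewrite mxE.
exact: KL.
Qed.

(** * Passage from differences to the Jacobian *)

Lemma at_right_scale_small (h : 'rV[R]_3) :
  \forall e \near (0 : R)^'+, 0 < e /\ `|e *: h| <= 8^-1.
Proof.
near=> e; have e0 : 0 < e by near: e; exact: nbhs_right_gt.
split=> //; rewrite normrZ gtr0_norm//; apply: le_trans (_ : e * (`|h| + 1) <= _).
  by rewrite ler_wpM2l ?lerDl// ltW.
rewrite -ler_pdivlMr; last by rewrite ltr_wpDl.
by apply/ltW; near: e; apply: nbhs_right_lt; rewrite divr_gt0// ltr_wpDl.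
Unshelve. all: by end_near. Qed.

Lemma gap_cvg T h j : 0 <= T ->
  gap (e *: h) T 0 j / e @[e --> 0^'+] --> (h *m jacobian (phi T) u) 0 j.
Proof.
move=> T0; have [K [K0 KL]] := jacobian_approx T0.
have K1 : 0 < K * `|h| ^+ 2 + 1 by apply: ltr_wpDl => //; apply: mulr_ge0 => //; exact: sqr_ge0.
apply/cvgrPdist_le => eps eps0; near=> e.
have [e0 he] : 0 < e /\ `|e *: h| <= 8^-1 by near: e; exact: at_right_scale_small.
have := KL _ j he; rewrite -scalemxAl [X in `|_ - X|]mxE normrZ gtr0_norm// distrC.
rewrite -(ler_pM2l (_ : 0 < e^-1)) ?invr_gt0//.
rewrite -[X in X * `|_| <= _]ger0_norm ?invr_ge0 ?(ltW e0)// -normrM => le_e.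
rewrite (_ : _ - _ =
  e^-1 * (e * (h *m jacobian (phi T) u) 0 j - gap (e *: h) T 0 j)); last first.
  by field; rewrite gt_eqF.
apply: le_trans le_e _.
rewrite (_ : e^-1 * _ = e * (K * `|h| ^+ 2)); last by field; rewrite gt_eqF.
apply: le_trans (_ : e * (K * `|h| ^+ 2 + 1) <= _).
  by rewrite ler_wpM2l ?lerDl// ltW.
rewrite -ler_pdivlMr//.
by apply/ltW; near: e; apply: nbhs_right_lt; rewrite divr_gt0.
Unshelve. all: by end_near. Qed.

(** Divide [gap_decay] for [e *: h] by [e ^+ 2] and let [e] tend to 0 from the right. *)
Lemma jacobian_energy T h : 0 <= T ->
  expR (- (2 * contraction_rate B C) * T) * energyv h <=
  energyv (h *m jacobian (phi T) u).
Proof.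
move=> T0.
have cv : energy B (gap (e *: h) T 0 0 / e) (gap (e *: h) T 0 1 / e)
    (gap (e *: h) T 0 2%:R / e) @[e --> 0^'+] --> energyv (h *m jacobian (phi T) u).
  apply: cvgD; first by apply: cvgM; exact: gap_cvg.
  apply: cvgM; first exact: cvg_cst.
  by apply: cvgD; apply: cvgM; exact: gap_cvg.
apply: (cvgr_to_ge cv); near=> e.
have [e0 he] : 0 < e /\ `|e *: h| <= 8^-1 by near: e; exact: at_right_scale_small.
have -> : energy B (gap (e *: h) T 0 0 / e) (gap (e *: h) T 0 1 / e)
    (gap (e *: h) T 0 2%:R / e) = energyv (gap (e *: h) T) / e ^+ 2.
  by rewrite /energyv /energy; field; rewrite gt_eqF.
rewrite ler_pdivlMr ?exprn_gt0//; apply: le_trans (gap_decay T0 he).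
rewrite -mulrA ler_wpM2l ?expR_ge0//.
rewrite /energyv /energy !mxE le_eqVlt; apply/orP; left; apply/eqP; ring.
Unshelve. all: by end_near. Qed.
Lemma gap_bound T : 0 <= T -> exists2 W : R, 0 <= W & forall h t j,
  `|h| <= 8^-1 -> 0 <= t <= T -> `|gap h t 0 j| <= W * `|h|.
Proof.
move=> T0; pose V := (1 + B^-1) * (expR ((B + 6) * T) * (1 + 2 * B)).
have BV : 0 <= 1 + B^-1 by rewrite addr_ge0// invr_ge0 ltW.
have V0 : 0 <= V.
  apply: mulr_ge0 => //; apply: mulr_ge0; first exact: expR_ge0.
  by move: B_gt0; lra.
exists (Num.sqrt V); first exact: sqrtr_ge0.
move=> h t j h8 /andP[t0 tT].
rewrite -ler_sqr ?nnegrE ?(mulr_ge0 (sqrtr_ge0 _))//.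
rewrite real_normK ?num_real// exprMn sqr_sqrtr//.
apply: le_trans (coord_le_energyv _ _) _.
rewrite /V -!mulrA; apply: ler_wpM2l => //.
apply: le_trans (gap_growth t0 h8) _.
apply: ler_pM; [exact: expR_ge0|exact: energy_ge0| |exact: energyv_le_norm].
by rewrite ler_expR ler_wpM2l//; move: B_gt0; lra.
Qed.

Let gap_det e t : R := det3
  (gap (basis e 0) t 0 0) (gap (basis e 0) t 0 1) (gap (basis e 0) t 0 2%:R)
  (gap (basis e 1) t 0 0) (gap (basis e 1) t 0 1) (gap (basis e 1) t 0 2%:R)
  (gap (basis e 2%:R) t 0 0) (gap (basis e 2%:R) t 0 1) (gap (basis e 2%:R) t 0 2%:R).

(** The determinant starts at [e ^+ 3]. In each source determinant one row is quadratic and two are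
    linear in [e], so the perturbation of Liouville's formula is of order [e ^+ 4]. *)
Lemma gap_det_le T : 0 <= T -> exists M : R, forall e, 0 < e <= 8^-1 ->
  `|gap_det e T| <= expR (- (C + 2) * T) * e ^+ 3 + M * e ^+ 4.
Proof.
move=> T0; have [W W0 gapW] := gap_bound T0.
(* Three source determinants, with six products each. *)
exists (18 * W ^+ 4) => e /andP[e0 e8]; set M := _ * e ^+ 4.
have M0 : 0 <= M.
  by apply: mulr_ge0; [apply: mulr_ge0 => //|]; apply: exprn_ge0 => //; exact: ltW.
have We0 : 0 <= W * e by rewrite mulr_ge0// ltW.
have gapWe i j t : 0 <= t <= T -> `|gap (basis e i) t 0 j| <= W * e.
  move=> tT; apply: le_trans (gapW _ t j _ tT) _.
    exact: le_trans (norm_basis i (ltW e0)) e8.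
  by rewrite ler_wpM2l// norm_basis// ltW.
have srcW i j t : 0 <= t <= T ->
    `|gap (basis e i) t 0 0 * gap (basis e i) t 0 j| <= (W * e) ^+ 2.
  by move=> tT; rewrite normrM expr2; apply: ler_pM => //; exact: gapWe.
have D := det3_deriv (gap_base T (basis e 0)) (gap_base T (basis e 1))
  (gap_base T (basis e 2%:R)).
have G0 : gap_det e 0 = e ^+ 3.
  by rewrite /gap_det !gap0 /basis !mxE /det3 /=; ring.
set S := (X in deriv_on _ _ (fun t => _ + X t)) in D.
have leS t : 0 < t < T -> `|S t| <= M.
  move=> /andP[t0 tT]; have ht : 0 <= t <= T by rewrite !ltW.
  have z0 : `|0 : R| <= (W * e) ^+ 2 by rewrite normr0 sqr_ge0.
  have -> : M = 6 * ((W * e) ^+ 2 * (W * e * (W * e))) +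
      6 * (W * e * ((W * e) ^+ 2 * (W * e))) + 6 * (W * e * (W * e * (W * e) ^+ 2)).
    by rewrite /M; ring.
  apply: le_trans (ler_normD _ _) _; apply: lerD; last first.
    by apply: normr_det3_le; rewrite ?normrN; auto.
  by apply: le_trans (ler_normD _ _) _; apply: lerD;
    apply: normr_det3_le; rewrite ?normrN; auto.
clearbody M; have C2 : 0 < C + 2 by move: C_gt0; lra.
have c0 : - (C + 2) != 0 by rewrite oppr_eq0 gt_eqF.
have MC : 0 <= M / (C + 2) <= M.
  apply/andP; split; first by apply: divr_ge0 => //; exact: ltW.
  by rewrite ler_pdivrMr// ler_peMr//; move: C_gt0; lra.
have Ee : 0 <= expR (- (C + 2) * T) * e ^+ 3.
  by apply: mulr_ge0; [exact: expR_ge0|apply: exprn_ge0; exact: ltW].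
have EM : 0 <= expR (- (C + 2) * T) * (M / (C + 2)).
  by apply: mulr_ge0; [exact: expR_ge0|case/andP: MC].
(* Gronwall's inequality is applied to both signs of the determinant, at the negative rate
   [- (C + 2)]. *)
rewrite ler_norml; apply/andP; split.
  have h : forall t, 0 < t < T -> -1 * (- (C + 2) * gap_det e t + S t) <=
      - (C + 2) * (-1 * gap_det e t) + M.
    by move=> t tT; have := leS t tT; rewrite ler_norml => /andP[]; lra.
  have := gronwall c0 T0 (deriv_onZ (-1) D) h.
  rewrite -/(gap_det e T) -/(gap_det e 0) G0 invrN mulrN; case/andP: MC EM.
  by move: (M / (C + 2)) (expR _) Ee => X E Ee X0 XM EX; lra.
have h : forall t, 0 < t < T -> - (C + 2) * gap_det e t + S t <=
    - (C + 2) * gap_det e t + M.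
  by move=> t tT; have := leS t tT; rewrite ler_norml => /andP[]; lra.
have := gronwall c0 T0 D h.
rewrite -/(gap_det e T) -/(gap_det e 0) G0 invrN mulrN; case/andP: MC EM.
by move: (M / (C + 2)) (expR _) Ee => X E Ee X0 XM EX; lra.
Qed.

(** Dividing [gap_det_le] by [e ^+ 3] leaves an error [M * e], which vanishes in the limit. *)
Lemma jacobian_det T : 0 <= T ->
  `|\det (jacobian (phi T) u)| <= expR (- (C + 2) * T).
Proof.
move=> T0; set L := jacobian (phi T) u; have [M leM] := gap_det_le T0.
have rowL i j : gap (basis e i) T 0 j / e @[e --> 0^'+] --> L i j.
  have -> : L i j = ((delta_mx 0 i : 'rV[R]_3) *m L) 0 j by rewrite -rowE [RHS]mxE.
  exact: gap_cvg.
have cvdet : `|gap_det e T / e ^+ 3| @[e --> 0^'+] --> `|\det L|.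
  apply: cvg_norm; rewrite det3E.
  have -> : (fun e => gap_det e T / e ^+ 3) = (fun e => det3
    (gap (basis e 0) T 0 0 / e) (gap (basis e 0) T 0 1 / e)
    (gap (basis e 0) T 0 2%:R / e)
    (gap (basis e 1) T 0 0 / e) (gap (basis e 1) T 0 1 / e)
    (gap (basis e 1) T 0 2%:R / e)
    (gap (basis e 2%:R) T 0 0 / e) (gap (basis e 2%:R) T 0 1 / e)
    (gap (basis e 2%:R) T 0 2%:R / e)).
    by apply/funext => e; rewrite /gap_det /det3 -exprVn; ring.
  apply: cvgD; [apply: cvgB|]; apply: cvgM; try exact: rowL;
    by apply: cvgB; apply: cvgM; exact: rowL.
have cvr : expR (- (C + 2) * T) + M * e @[e --> 0^'+] --> expR (- (C + 2) * T) + M * 0.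
  apply: cvgD; first exact: cvg_cst.
  by apply: cvgM; [exact: cvg_cst|exact: cvg_at_right_filter cvg_id].
rewrite -[leRHS]addr0 -[X in _ + X](mulr0 M).
apply: (ler_cvg_to cvdet cvr); near=> e.
have e0 : 0 < e by near: e; exact: nbhs_right_gt.
have e8 : 0 < e <= 8^-1 by rewrite e0; near: e; exact: nbhs_right_ltW.
rewrite normrM [`|_^-1|]gtr0_norm ?invr_gt0 ?exprn_gt0//.
rewrite ler_pdivrMr ?exprn_gt0//; apply: le_trans (leM e e8) _.
by rewrite mulrDl -mulrA -exprS.
Unshelve. all: by end_near. Qed.
End Base.
End VallisFlow.

(** * The Lyapunov dimension *)

(** For index 2, [a + b <= |c| - s] and [|c| <= L] give the bound at once. For index 1,
    [a <= |b| + |c| - s] is combined with [|b| <= |c|]. *)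
Lemma kaplan_yorke_le (R : realFieldType) (s L a b c : R) : 0 < s -> s <= 3 * L ->
  b <= a -> c <= b -> a + b + c <= - s -> - L <= c ->
  [/\ 0 <= 3 - s / L,
      0 <= a -> a + b < 0 -> 1 + a / `|b| <= 3 - s / L &
      0 <= a + b -> 2 + (a + b) / `|c| <= 3 - s / L].
Proof.
move=> s0 sL ba cb abc Lc; have L0 : 0 < L by lra.
have sdiv M : 0 < M -> M <= L -> s / L <= s / M.
  by move=> M0 ML; rewrite ler_pM2l// lef_pV2 ?posrE.
split.
- by rewrite subr_ge0 ler_pdivrMr.
- move=> a0 ab0; rewrite ltr0_norm; last by lra.
  pose M := - b; have M0 : 0 < M by rewrite /M; lra.
  (* If [s <= - c], the dimension is at most 2 and the bound at least 2. Otherwise [s - - c] is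
     positive, and [M <= - c] permits the comparison of quotients. *)
  rewrite -/M; have [sc|sc] := leP s (- c).
    have : s / L <= 1 by rewrite ler_pdivrMr//; lra.
    have : a / M <= 1 by rewrite ler_pdivrMr// /M; lra.
    by lra.
  have c0 : 0 < - c by lra.
  have h1 := sdiv (- c) c0 (_ : - c <= L); have {}h1 : s / L <= s / - c by apply: h1; lra.
  suff : a / M <= 2 - s / - c by lra.
  rewrite ler_pdivrMr// (_ : 2 - s / - c = 1 - (s - - c) / - c); last first.
    by field; rewrite lt_eqF//; lra.
  have h2 : (s - - c) / - c * M <= s - - c.
    by rewrite -mulrA ger_pMr ?subr_gt0// ler_pdivrMl ?mulr1// /M; lra.
  by move: h2; rewrite /M; move: ((s - - c) / - c) => X h2; lra.
- move=> ab0; have c0 : c < 0 by lra.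
  rewrite ltr0_norm//.
  have {sdiv} h1 := sdiv (- c); have {}h1 : s / L <= s / - c by apply: h1; lra.
  suff : (a + b) / - c <= 1 - s / - c by lra.
  rewrite ler_pdivrMr ?oppr_gt0// mulrBl divfK ?oppr_eq0 ?lt_eqF//; lra.
Qed.

Section LocalDimension.
Variables (R : realType) (phi : R -> 'rV[R]_3 -> 'rV[R]_3) (t : R) (u : 'rV[R]_3).

Lemma LEsumE : [/\ LEsum phi t u 0 = 0, LEsum phi t u 1 = LE phi t u 0,
  LEsum phi t u 2 = LE phi t u 0 + LE phi t u 1 &
  LEsum phi t u 3 = LE phi t u 0 + LE phi t u 1 + LE phi t u 2%:R].
Proof. by split; rewrite /LEsum big_mkcond sum3 /= ?addr0. Qed.

Lemma local_dimL_le s L : 0 < s -> s <= 3 * L ->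
  LE phi t u 1 <= LE phi t u 0 -> LE phi t u 2%:R <= LE phi t u 1 ->
  LE phi t u 0 + LE phi t u 1 + LE phi t u 2%:R <= - s ->
  - L <= LE phi t u 2%:R -> local_dimL phi t u <= 3 - s / L.
Proof.
move=> s0 sL ba cb abc Lc.
have [d0 d1 d2] := kaplan_yorke_le s0 sL ba cb abc Lc.
have [E0 E1 E2 E3] := LEsumE.
have i1 : inord 1 = 1 :> 'I_3 by apply: val_inj; rewrite /= inordK.
have i2 : inord 2 = 2%:R :> 'I_3 by apply: val_inj; rewrite /= inordK.
rewrite /local_dimL /KY_index big_mkcond !big_ord_recr big_ord0 /=.
rewrite E0 E1 E2 E3 lexx.
(* The sum of all three exponents is negative, which excludes index 3. *)
rewrite [0 <= _ + _ + LE _ _ _ _]lt_geF; last by lra.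
case: (leP 0 (LE phi t u 0 + LE phi t u 1)) => ab.
  rewrite (_ : (maxn _ 0) = 2%N); last by case: ifP.
  by rewrite /= E2 i2; exact: d2.
case: (leP 0 (LE phi t u 0)) => a0 /=; last exact: d0.
by rewrite E1 i1; exact: d1.
Qed.
End LocalDimension.

Lemma dotmx_selfE (R : realType) (v : 'rV[R]_3) :
  (v *m v^T) 0 0 = v 0 0 ^+ 2 + v 0 1 ^+ 2 + v 0 2%:R ^+ 2.
Proof. by rewrite mxE sum3 !mxE. Qed.

Lemma energyv_le_dotmx (R : realType) (B : R) (v : 'rV[R]_3) : 0 < B ->
  energyv B v <= (1 + B) * (v *m v^T) 0 0.
Proof.
move=> B0; rewrite dotmx_selfE /energyv /energy.
have := (sqr_ge0 (v 0 0), sqr_ge0 (v 0 1), sqr_ge0 (v 0 2%:R)).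
move: (v 0 0 ^+ 2) (v 0 1 ^+ 2) (v 0 2%:R ^+ 2) => x y z [[x0 y0] z0].
by have := mulr_ge0 (ltW B0) x0; lra.
Qed.

Lemma dotmx_le_energyv (R : realType) (B : R) (v : 'rV[R]_3) : 0 < B ->
  (v *m v^T) 0 0 <= (1 + B^-1) * energyv B v.
Proof.
move=> B0; rewrite dotmx_selfE /energyv /energy.
have := (sqr_ge0 (v 0 0), sqr_ge0 (v 0 1), sqr_ge0 (v 0 2%:R)).
move: (v 0 0 ^+ 2) (v 0 1 ^+ 2) (v 0 2%:R ^+ 2) => x y z [[x0 y0] z0].
have -> : (1 + B^-1) * (x + B * (y + z)) = x + y + z + (B^-1 * x + B * (y + z)).
  by field; rewrite gt_eqF.
by rewrite lerDl addr_ge0// mulr_ge0 ?invr_ge0 ?addr_ge0// ltW.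
Qed.

Theorem theorem1 (R : realType) (B C p : R)
    (phi : R -> 'rV[R]_3 -> 'rV[R]_3) (A : set 'rV[R]_3)
    (B_gt0 : 0 < B) (C_gt0 : 0 < C)
    (phi_vallis : semiflow_generated_by (vallis_field B C p) phi)
    (A_attractor : global_B_attractor phi A) :
  (dimL phi A <=
    (3 - 2 * (C + 2) / (C + 1 + Num.sqrt ((C - 1) ^+ 2 + 25 / 4 * B)))%:E)%E.
Proof.
have [_ _ bA invA _] := A_attractor.
set S := Num.sqrt _.
pose L := (C + 1 + S) / 2; pose L1 := contraction_rate B C.
have [L1C L1_gt1] := contraction_rate_gt C B_gt0.
have L1L : L1 < L.
  rewrite /L1 /L /contraction_rate ltr_pM2r// ltrD2l ltr_sqrt.
    by rewrite ltrD2l ltr_pM2r//; lra.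
  by rewrite ltr_wpDl ?sqr_ge0// mulr_gt0//; lra.
rewrite -/L1 in L1C L1_gt1.
have -> : 3 - 2 * (C + 2) / (C + 1 + S) = 3 - (C + 2) / L.
  have S0 : 0 <= S by exact: sqrtr_ge0.
  by rewrite /L; field; lra.
(* The cost of passing from the Euclidean norm to the energy and back, for squared norms. *)
pose k := (1 + B) * (1 + B^-1).
have k1 : 1 <= k.
  have BV : 0 < B^-1 by rewrite invr_gt0.
  by have := mulr_gt0 B_gt0 BV; rewrite /k !mulrDl !mulrDr; lra.
have lnk : 0 <= ln k by exact: ln_ge0.
(* The change of norm costs the exponents [ln k / (2 T)], which for this [T] is at most [L - L1]. As
   [dimL] is an infimum over times, one time suffices; the final [1] keeps it positive. *)
pose T := ln k / (2 * (L - L1)) + 1.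
have T0 : 0 < T.
  by rewrite /T ltr_wpDl// divr_ge0// mulr_ge0// subr_ge0 ltW.
have lnkT : ln k <= 2 * (L - L1) * T.
  rewrite /T mulrDr mulrCA divff ?mulr1; last by rewrite gt_eqF// mulr_gt0// subr_gt0.
  by rewrite lerDl mulr_ge0// subr_ge0 ltW.
apply: (@le_trans _ _ (ereal_sup [set (local_dimL phi T u)%:E | u in A])).
  by apply: ereal_inf_lbound; exists T.
apply: ge_ereal_sup => _ [u Au <-]; rewrite lee_fin.
have yz_u := yz2_attractor phi_vallis bA invA Au.
pose M := flow_jacobian phi T u; pose s (i : 'I_3) : R := singular_values M 0 i.
have [s_ge0 s_mono _] := singular_valuesP M.
(* [jacobian_energy] at the eigenvector [v] belonging to [s i]; the transpose in [flow_jacobian]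
   cancels the one in [v *m M^T]. *)
have s_low i : expR (- (2 * L1) * T) / k <= s i ^+ 2.
  have [v v0 vE] := singular_value_eigenvector M i.
  have vv := dotmx_self_gt0 v0.
  rewrite -(ler_pM2r vv) -vE trmxK.
  have := jacobian_energy B_gt0 C_gt0 phi_vallis yz_u v (ltW T0).
  have := energyv_le_dotmx (v *m jacobian (phi T) u) B_gt0.
  have := dotmx_le_energyv v B_gt0.
  rewrite -/L1; move: (expR_ge0 (- (2 * L1) * T)).
  move: (expR _) (energyv B v) (energyv B _) => E n m E0 h1 h2 h3.
  have B1 : 0 < 1 + B by lra.
  rewrite -(ler_pM2l B1); apply: le_trans (le_trans h3 h2).
  have -> : (1 + B) * (E / k * (v *m v^T) 0 0) = E * ((v *m v^T) 0 0 / (1 + B^-1)).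
    by rewrite /k; field; rewrite !gt_eqF ?addr_gt0 ?invr_gt0.
  apply: ler_wpM2l => //; rewrite ler_pdivrMr 1?mulrC//.
  by rewrite addr_gt0 ?invr_gt0.
have k0 : 0 < k by lra.
(* Strict positivity keeps [ln] away from its default values. *)
have s_gt0 i : 0 < s i.
  rewrite lt_def s_ge0 andbT; apply/negP => /eqP si0.
  have := s_low i; rewrite si0 expr0n/= => /le_gtF; rewrite divr_gt0 ?expR_gt0//.
have LEle (i j : 'I_3) : (i <= j)%N -> LE phi T u j <= LE phi T u i.
  move=> ij; rewrite /LE ler_wpM2l ?invr_ge0 ?(ltW T0)// ler_ln ?posrE ?s_gt0//.
  exact: s_mono.
(* The condition [C + 2 <= 3 * L] holds because [L] exceeds both [C] and 1. *)
apply: local_dimL_le; [lra|lra|exact: LEle|exact: LEle| |].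
- have sdet : s 0 * s 1 * s 2%:R <= expR (- (C + 2) * T).
    have := prod_singular_values M.
    rewrite prod3 -/(s 0) -/(s 1) -/(s 2%:R) => ->.
    apply: le_trans (jacobian_det B_gt0 C_gt0 phi_vallis yz_u (ltW T0)).
    by rewrite /M /flow_jacobian det_tr.
  rewrite /LE -!mulrDr -!lnM ?posrE ?mulr_gt0 ?s_gt0//.
  rewrite ler_pdivrMl// (_ : T * - (C + 2) = - (C + 2) * T); last by ring.
  by rewrite -[leRHS]expRK ler_ln ?posrE ?expR_gt0 ?mulr_gt0 ?s_gt0.
(* The logarithm of [s_low] gives [- 2 L1 T - ln k <= 2 ln s], and [lnkT] absorbs [ln k]. *)
- rewrite /LE. rewrite ler_pdivlMl//.
  have := s_low 2%:R; rewrite -ler_ln ?posrE ?exprn_gt0 ?divr_gt0 ?expR_gt0 ?s_gt0//.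
  rewrite ln_div ?posrE ?expR_gt0// expRK lnXn ?s_gt0//.
  rewrite -/M -/(s _) -mulr_natl; lra.
Qed.
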